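(* Let $H = (H,\mu_H,\Delta_H)$ be a bialgebra and let $C = (C,\Delta_C)$ be an $H$-comodule coalgebra via $\delta \colon C \to H \otimes C$. Let $\alpha_H \colon H \to H$ be a bialgebra endomorphism and $\alpha_C \colon C \to C$ a coalgebra endomorphism such that $$\delta \circ \alpha_C= (\alpha_H \otimes \alpha_C) \circ \delta.$$ Write $H_\alpha$ for the Hom-bialgebra $(H,\ \mu_{\alpha,H} = \alpha_H\circ\mu_H,\ \Delta_{\alpha,H} = \Delta_H\circ\alpha_H,\ \alpha_H)$ and $C_\alpha$ for the Hom-coassociative coalgebra $(C,\ \Delta_{\alpha,C} = \Delta_C\circ\alpha_C,\ \alpha_C)$. Then the map $$\delta_\alpha = \delta\circ\alpha_C \colon C \to H \otimes C$$ gives the Hom-coassociative coalgebra $C_\alpha$ the structure of an $H_\alpha$-comodule Hom-coalgebra.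
   Context: Vector spaces and linear maps are over a field $\mathbb{F}$ of any characteristic. For vector spaces $U,V$, $\tau_{U,V}\colon U\otimes V\to V\otimes U$ is the twist map $u\otimes v\mapsto v\otimes u$. A bialgebra $(H,\mu_H,\Delta_H)$ consists of an associative multiplication $\mu_H\colon H\otimes H\to H$ and a coassociative comultiplication $\Delta_H\colon H\to H\otimes H$ with $\Delta_H\circ\mu_H=\mu_H^{\otimes 2}\circ(\mathrm{id}_H\otimes\tau_{H,H}\otimes\mathrm{id}_H)\circ\Delta_H^{\otimes 2}$; units and counits are not part of the data. A bialgebra endomorphism is a linear map $\alpha_H$ with $\alpha_H\circ\mu_H=\mu_H\circ\alpha_H^{\otimes 2}$ and $\Delta_H\circ\alpha_H=\alpha_H^{\otimes 2}\circ\Delta_H$. A coalgebra $(C,\Delta_C)$ is a vector space with a coassociative comultiplication; a coalgebra endomorphism is a linear map $\alpha_C$ with $\Delta_C\circ\alpha_C=\alpha_C^{\otimes 2}\circ\Delta_C$. For a bialgebra $H$, a coalgebra $(C,\Delta_C)$ is an $H$-comodule coalgebra via a linear map $\delta\colon C\to H\otimes C$ if $(\mathrm{id}_H\otimes\delta)\circ\delta=(\Delta_H\otimes\mathrm{id}_C)\circ\delta$ and $(\mathrm{id}_H\otimes\Delta_C)\circ\delta=\delta_{CC}\circ\Delta_C$, where $\delta_{CC}(c\otimes d)=\sum c_{(-1)}d_{(-1)}\otimes c_{(0)}\otimes d_{(0)}$ with $\delta(c)=\sum c_{(-1)}\otimes c_{(0)}$ and the product taken with $\mu_H$. A Hom-module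 is a pair $(V,\alpha)$ with $V$ a vector space and $\alpha\colon V\to V$ linear; a morphism $(V,\alpha_V)\to(W,\alpha_W)$ is a linear map $f$ with $\alpha_W\circ f=f\circ\alpha_V$. The tensor product of $(V,\alpha_V)$ and $(W,\alpha_W)$ is $(V\otimes W,\alpha_V\otimes\alpha_W)$. A Hom-associative algebra is a triple $(A,\mu,\alpha)$ with $(A,\alpha)$ a Hom-module and $\mu\colon A\otimes A\to A$ linear such that $\alpha\circ\mu=\mu\circ\alpha^{\otimes 2}$ and $\mu\circ(\alpha\otimes\mu)=\mu\circ(\mu\otimes\alpha)$. A Hom-coassociative coalgebra is a triple $(C,\Delta,\alpha)$ with $(C,\alpha)$ a Hom-module and $\Delta\colon C\to C\otimes C$ linear such that $\Delta\circ\alpha=\alpha^{\otimes 2}\circ\Delta$ and $(\alpha\otimes\Delta)\circ\Delta=(\Delta\otimes\alpha)\circ\Delta$. A Hom-bialgebra is a quadruple $(H,\mu,\Delta,\alpha)$ such that $(H,\mu,\alpha)$ is a Hom-associative algebra, $(H,\Delta,\alpha)$ is a Hom-coassociative coalgebra, and $\Delta\circ\mu=\mu^{\otimes 2}\circ(\mathrm{id}_H\otimes\tau_{H,H}\otimes\mathrm{id}_H)\circ\Delta^{\otimes 2}$. For a Hom-bialgebra $(H,\mu,\Delta,\alpha_H)$ and a Hom-module $(M,\alpha_M)$, an $H$-comodule structure on $M$ is a linear map $\rho\colon M\to H\otimes M$ with $\rho\circ\alpha_M=(\alpha_H\otimes\alpha_M)\circ\rho$ and $(\alpha_H\otimes\rho)\circ\rho=(\Delta\otimes\alpha_M)\circ\rho$.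 For a Hom-bialgebra $(H,\mu,\Delta,\alpha_H)$ and a Hom-coassociative coalgebra $(D,\Delta_D,\alpha_D)$, an $H$-comodule Hom-coalgebra structure on $D$ is an $H$-comodule structure $\rho\colon D\to H\otimes D$ on $(D,\alpha_D)$ such that $(\alpha_H^2\otimes\Delta_D)\circ\rho=\rho_{DD}\circ\Delta_D$, where $\rho_{DD}\colon D\otimes D\to H\otimes D\otimes D$ is given by $\rho_{DD}(c\otimes d)=\sum \mu(c_{(-1)}\otimes d_{(-1)})\otimes c_{(0)}\otimes d_{(0)}$ with $\rho(c)=\sum c_{(-1)}\otimes c_{(0)}$. *)

(* Defs.v *)
From HB Require Import structures.
From mathcomp Require Import all_boot all_algebra.
From mathcomp Require Import boolp finmap monalg.

Set Implicit Arguments.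
Unset Strict Implicit.
Unset Printing Implicit Defensive.

Import GRing.Theory.
Local Open Scope ring_scope.

Definition is_bilinear (F : fieldType) (U V W : lmodType F) (f : U -> V -> W) :=
  (forall v, linear (f ^~ v)) /\ (forall u, linear (f u)).

(* Keeps unification from unfolding into the quotient construction. *)
Fact tensor_key : unit. Proof. exact: tt. Qed.

Section TensorProduct.
Variables (F : fieldType) (U V : lmodType F).

Local Notation free := {malg F[(U * V)%type]}.
Local Notation gen u v := (mkmalgU (u, v) (1 : F) : free).

Inductive bilin_relator : free -> Prop :=
| RelL a u u' v :
    bilin_relator (gen (a *: u + u') v - (a *: gen u v + gen u' v))
| RelR a u v v' :
    bilin_relator (gen u (a *: v + v') - (a *: gen u v + gen u v')).

(* The linear span of the bilinearity relations in the free module on U * V. *)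
Definition bilin_span : {pred free} := fun x =>
  `[< forall S : {pred free}, submod_closed S ->
        (forall r, bilin_relator r -> r \in S) -> x \in S >].

Fact bilin_span_submod : submod_closed bilin_span.
Proof.
split; first by apply/asboolP => S [S0 _] _.
move=> a x y /asboolP Sx /asboolP Sy; apply/asboolP => S Sl Sr.
by case: (Sl) => _ Sc; apply: Sc; [apply: Sx | apply: Sy].
Qed.

HB.instance Definition _ :=
  GRing.isSubmodClosed.Build F free bilin_span bilin_span_submod.

Lemma bilin_span_rel r : bilin_relator r -> r \in bilin_span.
Proof. by move=> Rr; apply/asboolP => S _; apply. Qed.

Definition tensor_type : Type := Quotient.quot bilin_span.
HB.instance Definition _ := GRing.Zmodule.on tensor_type.

Local Notation T := tensor_type.
Local Notation cls := (\pi_(Quotient.quot bilin_span)%qT : free -> T).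

Let clsE x y : (cls x = cls y) <-> (x - y \in bilin_span).
Proof.
by rewrite Quotient.idealrBE; split=> [/eqP | /eqP].
Qed.

Let clsB : {morph cls : x y / x - y}.
Proof.
by move=> x y; rewrite /= -(@pi_oppr _ _ _ _ _ (Quotient.quot bilin_span))
  -(@pi_addr _ _ _ _ _ (Quotient.quot bilin_span)).
Qed.

Let clsD : {morph cls : x y / x + y}.
Proof.
by move=> x y; rewrite /= -(@pi_addr _ _ _ _ _ (Quotient.quot bilin_span)).
Qed.

Definition tensor_scale (a : F) (t : T) : T := cls (a *: repr t).

Let cls_scale a x : tensor_scale a (cls x) = cls (a *: x).
Proof.
apply/clsE; rewrite -scalerBr rpredZ //; apply/clsE.
by rewrite /= reprK.
Qed.

Let clsP (t : T) : {x | t = cls x}.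
Proof. by exists (repr t); rewrite /= reprK. Qed.

Fact tensor_scaleA a b t :
  tensor_scale a (tensor_scale b t) = tensor_scale (a * b) t.
Proof. by have [x ->] := clsP t; rewrite !cls_scale scalerA. Qed.

Fact tensor_scale1 : left_id 1 tensor_scale.
Proof. by move=> t; have [x ->] := clsP t; rewrite !cls_scale scale1r. Qed.

Fact tensor_scaleDr : right_distributive tensor_scale +%R.
Proof.
move=> a t s; have [x ->] := clsP t; have [y ->] := clsP s.
by rewrite -clsD !cls_scale scalerDr clsD.
Qed.

Fact tensor_scaleDl t : {morph tensor_scale^~ t : a b / a + b}.
Proof.
by move=> a b; have [x ->] := clsP t; rewrite !cls_scale scalerDl clsD.
Qed.

HB.instance Definition _ := GRing.Zmodule_isLmodule.Build F tensor_type
  tensor_scaleA tensor_scale1 tensor_scaleDr tensor_scaleDl.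

Definition tensor : lmodType F := tensor_type.

Definition tens : U -> V -> tensor :=
  locked_with tensor_key (fun u v => cls (gen u v) : tensor).

Let tensE u v : tens u v = cls (gen u v).
Proof. by rewrite /tens unlock. Qed.

Fact tens_bilinear : is_bilinear tens.
Proof.
have eq0 x y : x - y \in bilin_span -> cls x = cls y by move/clsE.
split=> [v a u u' | u a v v'].
  rewrite /= !tensE (eq0 _ _ (bilin_span_rel (RelL a u u' v))).
  by rewrite clsD -cls_scale.
rewrite /= !tensE (eq0 _ _ (bilin_span_rel (RelR a u v v'))).
by rewrite clsD -cls_scale.
Qed.

HB.instance Definition _ u :=
  GRing.isLinear.Build F V tensor *:%R (tens u) (tens_bilinear.2 u).

Definition tensr (v : V) (u : U) : tensor := tens u v.

HB.instance Definition _ v :=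
  GRing.isLinear.Build F U tensor *:%R (tensr v) (tens_bilinear.1 v).

Lemma tensDZl a u u' v : tens (a *: u + u') v = a *: tens u v + tens u' v.
Proof. exact: tens_bilinear.1. Qed.

Lemma tensDZr a u v v' : tens u (a *: v + v') = a *: tens u v + tens u v'.
Proof. exact: tens_bilinear.2. Qed.

Lemma tensor_sum (t : tensor) :
  exists s : seq (U * V), t = \sum_(p <- s) tens p.1 p.2.
Proof.
have cls0 : cls 0 = 0 by rewrite -(subrr 0) clsB subrr.
have [x ->] := clsP t; rewrite [x]monalgE.
elim: (enum_fset _) => [|[u v] s [r IH]].
  by exists [::]; rewrite !big_nil.
exists ((x@_(u, v) *: u, v) :: r); rewrite !big_cons clsD -IH; congr (_ + _).
rewrite -/(tensr v (_ *: u)) linearZ /= /tensr tensE [RHS]cls_scale; congr cls.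
by apply/malgP => k; rewrite mcoeffZ !mcoeffU mulrnAr mulr1.
Qed.

Lemma eq_tensor (W : lmodType F) (f g : {linear tensor -> W}) :
  (forall u v, f (tens u v) = g (tens u v)) -> f =1 g.
Proof.
move=> fg t; have [s ->] := tensor_sum t.
by rewrite !linear_sum; apply: eq_bigr => p _; apply: fg.
Qed.

Section Lift.
Variables (W : lmodType F) (f : U -> V -> W) (hf : is_bilinear f).

Let ev (x : free) : W := \sum_(k <- msupp x) x@_k *: f k.1 k.2.

Let evw (d : {fset (U * V)%type}) x : (msupp x `<=` d)%fset ->
  ev x = \sum_(k <- d) x@_k *: f k.1 k.2.
Proof.
move=> le; rewrite [LHS](big_fset_incl _ le) => //= k _ /mcoeff_outdom ->.
by rewrite scale0r.
Qed.

Let ev_linear a x y : ev (a *: x + y) = a *: ev x + ev y.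
Proof.
pose d := (msupp x `|` msupp y `|` msupp (a *: x + y))%fset.
have dP z : z \in [:: x; y; a *: x + y] -> (msupp z `<=` d)%fset.
  rewrite !inE => /or3P[] /eqP->; apply/fsubsetP => k;
  by rewrite !in_fsetU => ->; rewrite ?orbT.
rewrite !(@evw d) ?dP ?inE ?eqxx ?orbT //.
rewrite scaler_sumr -big_split; apply: eq_bigr => k _ /=.
by rewrite mcoeffD mcoeffZ scalerDl scalerA.
Qed.

Let ev_gen u v : ev (gen u v) = f u v.
Proof.
by rewrite (evw (msuppU_le)) big_seq_fset1 mcoeffUU scale1r.
Qed.

Let evB y z : ev (y - z) = ev y - ev z.
Proof. by rewrite [y - z]addrC -(scaleN1r z) ev_linear scaleN1r addrC. Qed.

Let ev_span x : x \in bilin_span -> ev x = 0.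
Proof.
have ev0 : ev 0 = 0.
  by have := ev_linear (-1) 0 0; rewrite scaler0 addr0 scaleN1r addNr.
move=> /asboolP /(_ [pred x | ev x == 0]) Sx; apply/eqP/Sx.
  split=> [|a y z]; rewrite !inE ?ev0 // ev_linear => /eqP-> /eqP->.
  by rewrite scaler0 addr0.
move=> _ [a u u' v|a u v v']; rewrite inE evB ev_linear !ev_gen.
  by rewrite hf.1 subrr.
by rewrite hf.2 subrr.
Qed.

Definition tensor_lift_fun of is_bilinear f : tensor -> W :=
  locked_with tensor_key (fun t : tensor => ev (repr t)).

Let lift_cls x : tensor_lift_fun hf (cls x) = ev x.
Proof.
rewrite /tensor_lift_fun unlock.
by apply/eqP; rewrite -subr_eq0 -evB ev_span //; apply/clsE; rewrite /= reprK.
Qed.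

Fact tensor_lift_linear : linear (tensor_lift_fun hf).
Proof.
move=> a t s; have [x ->] := clsP t; have [y ->] := clsP s.
by rewrite [a *: _]cls_scale -clsD !lift_cls ev_linear.
Qed.

HB.instance Definition _ :=
  GRing.isLinear.Build F tensor W *:%R (tensor_lift_fun hf) tensor_lift_linear.

Definition tensor_lift : {linear tensor -> W} := tensor_lift_fun hf.

Lemma tensor_liftE u v : tensor_lift (tens u v) = f u v.
Proof. by rewrite /= tensE lift_cls ev_gen. Qed.

End Lift.

End TensorProduct.

Arguments tens {F U V}.
Arguments tensor_lift {F U V W} f hf.
Arguments tensr {F U V} v u.

Reserved Notation "U ⊗ V" (at level 40, left associativity).
Reserved Notation "f ⊗₁ g" (at level 40, left associativity).
Notation "U ⊗ V" := (tensor U V) : ring_scope.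

Section TensorMap.
Variables (F : fieldType) (U V U' V' : lmodType F).
Variables (f : {linear U -> U'}) (g : {linear V -> V'}).

Fact tensor_map_bilinear :
  is_bilinear (fun u v => tens (f u) (g v) : U' ⊗ V').
Proof.
by split=> [v a u u' | u a v v']; rewrite linearP (tensDZl, tensDZr).
Qed.

Definition tensor_map : {linear U ⊗ V -> U' ⊗ V'} :=
  tensor_lift _ tensor_map_bilinear.

Lemma tensor_mapE u v : tensor_map (tens u v) = tens (f u) (g v).
Proof. exact: tensor_liftE. Qed.

End TensorMap.

(* Otherwise [/=] unfolds such a map to its lift as soon as it is applied. *)
#[global] Opaque tensor_map.
Notation "f ⊗₁ g" := (tensor_map f g) : ring_scope.

Section TensorIsos.
Variables (F : fieldType) (U V W : lmodType F).

Fact twist_bilinear : is_bilinear (fun (u : U) (v : V) => tens v u).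
Proof. by split=> [v a u u' | u a v v']; rewrite (tensDZl, tensDZr). Qed.

Definition twist : {linear U ⊗ V -> V ⊗ U} := tensor_lift _ twist_bilinear.

Lemma twistE u v : twist (tens u v) = tens v u.
Proof. exact: tensor_liftE. Qed.

Fact assoc_bilinear :
  is_bilinear (fun (x : U ⊗ V) (w : W) => (idfun ⊗₁ tensr w) x : U ⊗ (V ⊗ W)).
Proof.
split=> [w | x a w w']; first exact: linearP.
apply: (@eq_tensor _ _ _ _ (idfun ⊗₁ tensr (a *: w + w'))
  (a \*: (idfun ⊗₁ tensr w) \+ (idfun ⊗₁ tensr w'))%R) => u v.
by rewrite /= !tensor_mapE /= /tensr !tensDZr.
Qed.

Definition assoc : {linear (U ⊗ V) ⊗ W -> U ⊗ (V ⊗ W)} :=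
  tensor_lift _ assoc_bilinear.

Lemma assocE u v w : assoc (tens (tens u v) w) = tens u (tens v w).
Proof. by rewrite tensor_liftE tensor_mapE. Qed.

Fact unassoc_bilinear :
  is_bilinear (fun (u : U) (y : V ⊗ W) => (tens u ⊗₁ idfun) y : (U ⊗ V) ⊗ W).
Proof.
split=> [y a u u' | u]; last exact: linearP.
apply: (@eq_tensor _ _ _ _ (tens (a *: u + u') ⊗₁ idfun)
  (a \*: (tens u ⊗₁ idfun) \+ (tens u' ⊗₁ idfun))%R) => v w.
by rewrite /= !tensor_mapE /= !tensDZl.
Qed.

Definition unassoc : {linear U ⊗ (V ⊗ W) -> (U ⊗ V) ⊗ W} :=
  tensor_lift _ unassoc_bilinear.

Lemma unassocE u v w : unassoc (tens u (tens v w)) = tens (tens u v) w.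
Proof. by rewrite tensor_liftE tensor_mapE. Qed.

End TensorIsos.

#[global] Opaque twist assoc unassoc.

(* Tensor products are not strictly associative: iterated ones are bracketed and
   the isomorphism [assoc] is inserted wherever the bracketings differ. *)

Section TensorCalculus.
Variable F : fieldType.
Implicit Types U V W X : lmodType F.

Lemma eq_tensor3 U V W X (f g : {linear (U ⊗ V) ⊗ W -> X}) :
  (forall u v w, f (tens (tens u v) w) = g (tens (tens u v) w)) -> f =1 g.
Proof.
move=> fg; apply: eq_tensor => t w.
by apply: (@eq_tensor _ _ _ _ (f \o tensr w) (g \o tensr w)) => u v; apply: fg.
Qed.

Lemma eq_tensor4 U V W X (Y : lmodType F)
    (f g : {linear (U ⊗ V) ⊗ (W ⊗ X) -> Y}) :
  (forall u v w x,
     f (tens (tens u v) (tens w x)) = g (tens (tens u v) (tens w x))) ->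
  f =1 g.
Proof.
move=> fg; apply: eq_tensor => t s.
apply: (@eq_tensor _ _ _ _ (f \o tensr s) (g \o tensr s)) => u v.
apply: (@eq_tensor _ _ _ _ (f \o tens (tens u v)) (g \o tens (tens u v))).
by move=> w x; apply: fg.
Qed.

Lemma eq_tensor_map U V U' V' (f f' : {linear U -> U'})
    (g g' : {linear V -> V'}) :
  f =1 f' -> g =1 g' -> f ⊗₁ g =1 f' ⊗₁ g'.
Proof. by move=> ff gg; apply: eq_tensor => u v; rewrite !tensor_mapE ff gg. Qed.

Lemma tensor_map_split U V U' V' U'' V''
    (f : {linear U -> U''}) (f2 : {linear U' -> U''}) (f1 : {linear U -> U'})
    (g : {linear V -> V''}) (g2 : {linear V' -> V''}) (g1 : {linear V -> V'}) x :
  f =1 f2 \o f1 -> g =1 g2 \o g1 ->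
  (f ⊗₁ g) x = (f2 ⊗₁ g2) ((f1 ⊗₁ g1) x).
Proof.
move=> ff gg; move: x.
apply: (@eq_tensor _ _ _ _ _ ((f2 ⊗₁ g2) \o (f1 ⊗₁ g1))) => u v.
by rewrite /= !tensor_mapE ff gg.
Qed.

Lemma assoc_natural U V W U' V' W' (f : {linear U -> U'})
    (g : {linear V -> V'}) (h : {linear W -> W'}) x :
  assoc U' V' W' (((f ⊗₁ g) ⊗₁ h) x) = (f ⊗₁ (g ⊗₁ h)) (assoc U V W x).
Proof.
move: x; apply: (@eq_tensor3 _ _ _ _ (assoc U' V' W' \o ((f ⊗₁ g) ⊗₁ h))
  ((f ⊗₁ (g ⊗₁ h)) \o assoc U V W)) => u v w /=.
by rewrite !(tensor_mapE, assocE).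
Qed.

Definition interchange U V W X :
    {linear (U ⊗ V) ⊗ (W ⊗ X) -> (U ⊗ W) ⊗ (V ⊗ X)} :=
  unassoc U W (V ⊗ X)
    \o (idfun ⊗₁ (assoc W V X \o (twist V W ⊗₁ idfun) \o unassoc V W X))
    \o assoc U V (W ⊗ X).

Lemma interchangeE U V W X u v w x :
  interchange U V W X (tens (tens u v) (tens w x)) =
  tens (tens u w) (tens v x).
Proof.
by rewrite /= assocE tensor_mapE /= unassocE tensor_mapE twistE assocE unassocE.
Qed.

End TensorCalculus.

#[global] Opaque interchange.

Lemma interchange_natural (F : fieldType)
    (U V W X U' V' W' X' : lmodType F) (f : {linear U -> U'})
    (g : {linear V -> V'}) (h : {linear W -> W'}) (k : {linear X -> X'}) x :
  interchange U' V' W' X' (((f ⊗₁ g) ⊗₁ (h ⊗₁ k)) x) =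
  ((f ⊗₁ h) ⊗₁ (g ⊗₁ k)) (interchange U V W X x).
Proof.
move: x; apply: (@eq_tensor4 _ _ _ _ _ _
  (interchange U' V' W' X' \o ((f ⊗₁ g) ⊗₁ (h ⊗₁ k)))
  (((f ⊗₁ h) ⊗₁ (g ⊗₁ k)) \o interchange U V W X)) => u v w x /=.
by rewrite !(tensor_mapE, interchangeE).
Qed.

Section Structures.
Variable F : fieldType.
Implicit Types A C M : lmodType F.

Definition associative_mul A (mu : {linear A ⊗ A -> A}) : Prop :=
  mu \o (mu ⊗₁ idfun) =1 mu \o (idfun ⊗₁ mu) \o assoc A A A.

Definition coassociative C (Delta : {linear C -> C ⊗ C}) : Prop :=
  assoc C C C \o (Delta ⊗₁ idfun) \o Delta =1 (idfun ⊗₁ Delta) \o Delta.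

(* Delta is multiplicative; [interchange] is id ⊗ twist ⊗ id. *)
Definition mul_comul_compatible A
    (mu : {linear A ⊗ A -> A}) (Delta : {linear A -> A ⊗ A}) : Prop :=
  Delta \o mu =1 (mu ⊗₁ mu) \o interchange A A A A \o (Delta ⊗₁ Delta).

(* Not required to be unital or counital. *)
Record bialgebra := Bialgebra {
  bialgebra_mod :> lmodType F;
  bmul : {linear bialgebra_mod ⊗ bialgebra_mod -> bialgebra_mod};
  bcomul : {linear bialgebra_mod -> bialgebra_mod ⊗ bialgebra_mod};
  bmulA : associative_mul bmul;
  bcomulA : coassociative bcomul;
  bmul_comul : mul_comul_compatible bmul bcomul }.

Record coalgebra := Coalgebra {
  coalgebra_mod :> lmodType F;
  comul : {linear coalgebra_mod -> coalgebra_mod ⊗ coalgebra_mod};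
  comulA : coassociative comul }.

Definition coalgebra_endo (C : coalgebra) (alpha : {linear C -> C}) : Prop :=
  comul C \o alpha =1 (alpha ⊗₁ alpha) \o comul C.

Definition bialgebra_endo (H : bialgebra) (alpha : {linear H -> H}) : Prop :=
  alpha \o bmul H =1 bmul H \o (alpha ⊗₁ alpha) /\
  bcomul H \o alpha =1 (alpha ⊗₁ alpha) \o bcomul H.

(* The map c ⊗ d |-> mu (c_(-1) ⊗ d_(-1)) ⊗ (c_(0) ⊗ d_(0)). *)
Definition codiag A M (mu : {linear A ⊗ A -> A}) (rho : {linear M -> A ⊗ M}) :
    {linear M ⊗ M -> A ⊗ (M ⊗ M)} :=
  (mu ⊗₁ idfun) \o interchange A M A M \o (rho ⊗₁ rho).

Definition comodule_coalgebra (H : bialgebra) (C : coalgebra)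
    (delta : {linear C -> H ⊗ C}) : Prop :=
  (idfun ⊗₁ delta) \o delta =1 assoc H H C \o (bcomul H ⊗₁ idfun) \o delta /\
  (idfun ⊗₁ comul C) \o delta =1 codiag (bmul H) delta \o comul C.

Definition hom_associative A (mu : {linear A ⊗ A -> A})
    (alpha : {linear A -> A}) : Prop :=
  alpha \o mu =1 mu \o (alpha ⊗₁ alpha) /\
  mu \o (alpha ⊗₁ mu) \o assoc A A A =1 mu \o (mu ⊗₁ alpha).

Definition hom_coassociative C (Delta : {linear C -> C ⊗ C})
    (alpha : {linear C -> C}) : Prop :=
  Delta \o alpha =1 (alpha ⊗₁ alpha) \o Delta /\
  (alpha ⊗₁ Delta) \o Delta =1 assoc C C C \o (Delta ⊗₁ alpha) \o Delta.

Record hom_bialgebra := HomBialgebra {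
  hom_bialgebra_mod :> lmodType F;
  hbmul : {linear hom_bialgebra_mod ⊗ hom_bialgebra_mod -> hom_bialgebra_mod};
  hbcomul : {linear hom_bialgebra_mod -> hom_bialgebra_mod ⊗ hom_bialgebra_mod};
  hbmap : {linear hom_bialgebra_mod -> hom_bialgebra_mod};
  hbmulA : hom_associative hbmul hbmap;
  hbcomulA : hom_coassociative hbcomul hbmap;
  hbmul_comul : mul_comul_compatible hbmul hbcomul }.

Record hom_coalgebra := HomCoalgebra {
  hom_coalgebra_mod :> lmodType F;
  hcomul : {linear hom_coalgebra_mod -> hom_coalgebra_mod ⊗ hom_coalgebra_mod};
  hcmap : {linear hom_coalgebra_mod -> hom_coalgebra_mod};
  hcomulA : hom_coassociative hcomul hcmap }.

Definition hom_comodule (H : hom_bialgebra) M (alpha : {linear M -> M})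
    (rho : {linear M -> H ⊗ M}) : Prop :=
  rho \o alpha =1 (hbmap H ⊗₁ alpha) \o rho /\
  (hbmap H ⊗₁ rho) \o rho =1 assoc H H M \o (hbcomul H ⊗₁ alpha) \o rho.

Definition comodule_hom_coalgebra (H : hom_bialgebra) (D : hom_coalgebra)
    (rho : {linear D -> H ⊗ D}) : Prop :=
  hom_comodule (hcmap D) rho /\
  ((hbmap H \o hbmap H) ⊗₁ hcomul D) \o rho =1
    codiag (hbmul H) rho \o hcomul D.

End Structures.
Section Twisting.
Variable F : fieldType.

Lemma twist_hom_coassociative (C : lmodType F) (Delta : {linear C -> C ⊗ C})
    (alpha : {linear C -> C}) :
  coassociative Delta -> Delta \o alpha =1 (alpha ⊗₁ alpha) \o Delta ->
  hom_coassociative (Delta \o alpha) alpha.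
Proof.
move=> coA Da; split=> c; first exact: Da.
set Da' : {linear C -> C ⊗ C} := reverse_coercion _ _ in Da *.
rewrite /comp.
rewrite (@tensor_map_split _ _ _ _ _ _ _ alpha alpha idfun
  Da' (alpha ⊗₁ alpha) Delta) //.
rewrite (@tensor_map_split _ _ _ _ _ _ _ Da' (alpha ⊗₁ alpha) Delta
  alpha alpha idfun) //.
rewrite assoc_natural.
by congr (_ _); rewrite -[LHS]coA.
Qed.

Lemma twist_hom_associative (A : lmodType F) (mu : {linear A ⊗ A -> A})
    (alpha : {linear A -> A}) :
  associative_mul mu -> alpha \o mu =1 mu \o (alpha ⊗₁ alpha) ->
  hom_associative (alpha \o mu) alpha.
Proof.
move=> muA am; split=> x; first by congr (alpha _); apply: am.
set am' : {linear A ⊗ A -> A} := reverse_coercion _ _ in am *.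
rewrite /comp.
rewrite (@tensor_map_split _ _ _ _ _ _ _ alpha alpha idfun am' alpha mu) //.
rewrite (@tensor_map_split _ _ _ _ _ _ _ am' alpha mu alpha alpha idfun) //.
rewrite /=; congr (alpha _).
by rewrite -![mu ((alpha ⊗₁ alpha) _)]am; congr (alpha _); apply/esym/muA.
Qed.

Lemma twist_mul_comul_compatible (A : lmodType F) (mu : {linear A ⊗ A -> A})
    (Delta : {linear A -> A ⊗ A}) (alpha : {linear A -> A}) :
  mul_comul_compatible mu Delta ->
  alpha \o mu =1 mu \o (alpha ⊗₁ alpha) ->
  Delta \o alpha =1 (alpha ⊗₁ alpha) \o Delta ->
  mul_comul_compatible (alpha \o mu) (Delta \o alpha).
Proof.
move=> md am Da x; rewrite /comp.
rewrite (@tensor_map_split _ _ _ _ _ _ _ _ alpha mu _ alpha mu) //.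
rewrite (@tensor_map_split _ _ _ _ _ _ _ _ Delta alpha _ Delta alpha) //.
rewrite /=.
have := md ((alpha ⊗₁ alpha) x); rewrite /comp => <-.
have := Da (mu ((alpha ⊗₁ alpha) x)); rewrite /comp => <-.
by congr (Delta (alpha _)); apply: am.
Qed.

Definition twisted_bialgebra (H : bialgebra F) (alpha : {linear H -> H})
    (endo : bialgebra_endo alpha) : hom_bialgebra F :=
  {| hbmul := alpha \o bmul H;
     hbcomul := bcomul H \o alpha;
     hbmap := alpha;
     hbmulA := twist_hom_associative (@bmulA _ H) endo.1;
     hbcomulA := twist_hom_coassociative (@bcomulA _ H) endo.2;
     hbmul_comul :=
       twist_mul_comul_compatible (@bmul_comul _ H) endo.1 endo.2 |}.

Definition twisted_coalgebra (C : coalgebra F) (alpha : {linear C -> C})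
    (endo : coalgebra_endo alpha) : hom_coalgebra F :=
  {| hcomul := comul C \o alpha;
     hcmap := alpha;
     hcomulA := twist_hom_coassociative (@comulA _ C) endo |}.

End Twisting.

(* Main.v *)
Require Import Defs.
From mathcomp Require Import all_boot all_algebra.

Set Implicit Arguments.
Unset Strict Implicit.
Unset Printing Implicit Defensive.

Import GRing.Theory.
Local Open Scope ring_scope.

(** All the twisting maps can be slid to one end by equivariance and the endomorphism laws. Each
    Hom-axiom then becomes the matching untwisted axiom of [delta], evaluated at an iterate of
    [alphaC] and followed by a map built from copies of [alphaH] and [alphaC]. [tensor_map_split]
    does the sliding inside tensor factors. *)

Theorem theorem1p2 (F : fieldType) (H : bialgebra F) (C : coalgebra F)
    (delta : {linear C -> H ⊗ C}) (delta_comod : comodule_coalgebra delta)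
    (alphaH : {linear H -> H}) (alphaH_endo : bialgebra_endo alphaH)
    (alphaC : {linear C -> C}) (alphaC_endo : coalgebra_endo alphaC)
    (delta_equiv : delta \o alphaC =1 (alphaH ⊗₁ alphaC) \o delta) :
  @comodule_hom_coalgebra F
    (twisted_bialgebra alphaH_endo) (twisted_coalgebra alphaC_endo)
    (delta \o alphaC).
Proof.
have [deltaA delta_comul] := delta_comod; have [_ DaH] := alphaH_endo.
split; first split=> c; first exact: delta_equiv.
- rewrite /=.
  (* Both sides become [alphaH ⊗₁ (alphaH ⊗₁ alphaC)] applied to a side of coassociativity of
     [delta] at [alphaC c]. *)
  rewrite (@tensor_map_split _ _ _ _ _ _ _ _ alphaH idfun
    _ (alphaH ⊗₁ alphaC) delta) //.
  rewrite (@tensor_map_split _ _ _ _ _ _ _ _ (alphaH ⊗₁ alphaH) (bcomul H)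
    _ alphaC idfun) //.
  rewrite assoc_natural; congr (_ _); exact: deltaA.
- move=> c; rewrite /= /codiag /=.
  rewrite (@tensor_map_split _ _ _ _ _ _ _ _ alphaH (bmul H)
    _ idfun idfun) //.
  rewrite (@tensor_map_split _ _ _ _ _ _ _ _ delta alphaC _ delta alphaC) //.
  (* The right side collapses to [(alphaH ⊗₁ idfun) ((idfun ⊗₁ comul C) (delta (alphaC (alphaC
     c))))]. *)
  rewrite -[(alphaC ⊗₁ alphaC) _]alphaC_endo.
  rewrite -[(bmul H ⊗₁ idfun) _]delta_comul.
  (* Of the two copies of [alphaH] on the left, one is absorbed by equivariance; the other matches
     the twist of the product. *)
  rewrite (@tensor_map_split _ _ _ _ _ _ _ _ alphaH alphaH
    _ (comul C) alphaC) //.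
  rewrite -[(alphaH ⊗₁ alphaC) _]delta_equiv.
  exact: (@tensor_map_split _ _ _ _ _ _ _ _ alphaH idfun _ idfun (comul C)).
Qed.
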